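(* Let $1\le n\le N$, $1\le\ell\le n-1$, $\bar\ell=n-\ell$, $i\in\{1,\dots,r_n\}$ and $j\in\{1,\dots,r_\ell\}$. Then $$H^{n\bar\ell}_{ij}=\frac{D_{n\bar\ell}^{\alpha-1}}{\Gamma(\alpha)}\,\frac{k_\ell}{2}\bigl(\Psi_{ni}(1)\mathcal{A}^{n\bar\ell}_j-\Psi_{ni}(-1)\mathcal{B}^{n\bar\ell}_j-\mathcal{C}^{n\bar\ell}_{ij}\bigr),$$ where $$\mathcal{A}^{n\bar\ell}_j=\int_{-1}^1\bigl(1+\Delta_{n\bar\ell}(1,\sigma)\bigr)^{\alpha-1}\Psi_{\ell j}(\sigma)\,d\sigma,\qquad \mathcal{B}^{n\bar\ell}_j=\int_{-1}^1\bigl(1+\Delta_{n\bar\ell}(-1,\sigma)\bigr)^{\alpha-1}\Psi_{\ell j}(\sigma)\,d\sigma,$$ $$\mathcal{C}^{n\bar\ell}_{ij}=\int_{-1}^1\Psi_{ni}'(\tau)\int_{-1}^1\bigl(1+\Delta_{n\bar\ell}(\tau,\sigma)\bigr)^{\alpha-1}\Psi_{\ell j}(\sigma)\,d\sigma\,d\tau .$$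
   Context: Fix $0<\alpha<1$ and set $\omega_\alpha(t)=t^{\alpha-1}/\Gamma(\alpha)$ for $t>0$. Let $0=t_0<t_1<\cdots<t_N=T$ be a grid, $k_n=t_n-t_{n-1}$ and $I_n=(t_{n-1},t_n)$. For integers $r_1,\dots,r_N\ge1$ and each $1\le n\le N$, let $\psi_{n1},\dots,\psi_{nr_n}$ be a basis of $\mathbb{P}_{r_n-1}$, the space of real polynomials of degree at most $r_n-1$. Define the affine map $\mathsf{t}_n:[-1,1]\to[t_{n-1},t_n]$ by $\mathsf{t}_n(\tau)=\tfrac12[(1-\tau)t_{n-1}+(1+\tau)t_n]$ and set $\Psi_{nj}(\tau)=\psi_{nj}(\mathsf{t}_n(\tau))$ for $-1\le\tau\le1$. For $1\le\ell\le n-1$ write $\bar\ell=n-\ell$ and define $$\rho^{n\bar\ell}_j(t)=\int_{I_\ell}\omega_\alpha(t-s)\psi_{\ell j}(s)\,ds\quad(t\in I_n),\qquad H^{n\bar\ell}_{ij}=\int_{I_n}(\rho^{n\bar\ell}_j)'(t)\,\psi_{ni}(t)\,dt .$$ Here superscripts and subscripts $n\bar\ell$ mean the pair $(n,\bar\ell)=(n,n-\ell)$. Finally, let $t_{n-1/2}=\tfrac12(t_{n-1}+t_n)$, $$D_{n\bar\ell}=t_{n-1/2}-t_{\ell-1/2},\qquad \Delta_{n\bar\ell}(\tau,\sigma)=\frac{\tau k_n-\sigma k_\ell}{2D_{n\bar\ell}},$$ so that $\mathsf{t}_n(\tau)-\mathsf{t}_\ell(\sigma)=D_{n\bar\ell}\bigl(1+\Delta_{n\bar\ell}(\tau,\sigma)\bigr)$.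 *)

(* Defs.v *)
From HB Require Import structures.
From mathcomp Require Import all_boot all_order all_algebra.
From mathcomp Require Import all_classical all_reals all_analysis.

Set Implicit Arguments.
Unset Strict Implicit.
Unset Printing Implicit Defensive.

Import Order.TTheory GRing.Theory Num.Theory.
Import numFieldNormedType.Exports.

Local Open Scope classical_set_scope.
Local Open Scope ring_scope.

(* All integrals are Lebesgue integrals: for l = n - 1 the derivative of rho and
   the integrand of Bcoef are unbounded (but integrable).  What is indexed on
   paper by the pair (n, n - l) is indexed here by (n, l). *)

(* Euler's integral; meaningful for 0 < a. *)
Definition Gamma (R : realType) (a : R) : R :=
  \int[lebesgue_measure]_(x in `]0, +oo[) (x `^ (a - 1) * expR (- x)).

(* Meaningful for 0 < x only. *)
Definition omega_kernel (R : realType) (alpha x : R) : R :=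
  x `^ (alpha - 1) / Gamma alpha.

Definition step (R : realType) (t : nat -> R) (n : nat) : R := t n - t n.-1.

Definition midpoint (R : realType) (t : nat -> R) (n : nat) : R :=
  (t n.-1 + t n) / 2.

Definition subint (R : realType) (t : nat -> R) (n : nat) : set R :=
  `]t n.-1, t n[.

Definition refmap (R : realType) (t : nat -> R) (n : nat) (tau : R) : R :=
  ((1 - tau) * t n.-1 + (1 + tau) * t n) / 2.

(* {poly_(r n) R} is the space of polynomials of degree at most r n - 1.
   The indices j = 1, ..., r n are represented by 'I_(r n). *)
Definition psifun (R : realType) (r : nat -> nat)
    (psi : forall n, (r n).-tuple {poly_(r n) R}) (n : nat) (j : 'I_(r n))
    (s : R) : R :=
  (polyn (tnth (psi n) j)).[s].

(* Psi is polynomial on all of R, so that derive1 of Psi is the derivative on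
   [-1, 1], endpoints included. *)
Definition Psi (R : realType) (t : nat -> R) (r : nat -> nat)
    (psi : forall n, (r n).-tuple {poly_(r n) R}) (n : nat) (j : 'I_(r n))
    (tau : R) : R :=
  psifun psi j (refmap t n tau).

Definition rho (R : realType) (alpha : R) (t : nat -> R) (r : nat -> nat)
    (psi : forall n, (r n).-tuple {poly_(r n) R}) (l : nat) (j : 'I_(r l))
    (x : R) : R :=
  \int[lebesgue_measure]_(s in subint t l)
    (omega_kernel alpha (x - s) * psifun psi j s).

Definition Hcoef (R : realType) (alpha : R) (t : nat -> R) (r : nat -> nat)
    (psi : forall n, (r n).-tuple {poly_(r n) R}) (n l : nat)
    (i : 'I_(r n)) (j : 'I_(r l)) : R :=
  \int[lebesgue_measure]_(x in subint t n)
    (derive1 (rho alpha t psi j) x * psifun psi i x).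

Definition Ddist (R : realType) (t : nat -> R) (n l : nat) : R :=
  midpoint t n - midpoint t l.

Definition Delta (R : realType) (t : nat -> R) (n l : nat)
    (tau sigma : R) : R :=
  (tau * step t n - sigma * step t l) / (2 * Ddist t n l).

Definition Acoef (R : realType) (alpha : R) (t : nat -> R) (r : nat -> nat)
    (psi : forall n, (r n).-tuple {poly_(r n) R}) (n l : nat)
    (j : 'I_(r l)) : R :=
  \int[lebesgue_measure]_(sigma in `[-1, 1])
    ((1 + Delta t n l 1 sigma) `^ (alpha - 1) * Psi t psi j sigma).

Definition Bcoef (R : realType) (alpha : R) (t : nat -> R) (r : nat -> nat)
    (psi : forall n, (r n).-tuple {poly_(r n) R}) (n l : nat)
    (j : 'I_(r l)) : R :=
  \int[lebesgue_measure]_(sigma in `[-1, 1])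
    ((1 + Delta t n l (-1) sigma) `^ (alpha - 1) * Psi t psi j sigma).

Definition Ccoef (R : realType) (alpha : R) (t : nat -> R) (r : nat -> nat)
    (psi : forall n, (r n).-tuple {poly_(r n) R}) (n l : nat)
    (i : 'I_(r n)) (j : 'I_(r l)) : R :=
  \int[lebesgue_measure]_(tau in `[-1, 1])
    (derive1 (Psi t psi i) tau *
     \int[lebesgue_measure]_(sigma in `[-1, 1])
       ((1 + Delta t n l tau sigma) `^ (alpha - 1) * Psi t psi j sigma)).

(* Main.v *)
Require Import Defs.
From HB Require Import structures.
From mathcomp Require Import all_boot all_order all_algebra.
From mathcomp Require Import all_classical all_reals all_analysis.
From mathcomp Require Import measurable_realfun ring lra.

Set Implicit Arguments.
Unset Strict Implicit.
Unset Printing Implicit Defensive.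

Import Order.TTheory GRing.Theory Num.Theory.
Import numFieldNormedType.Exports.

Local Open Scope classical_set_scope.
Local Open Scope ring_scope.

(** The identity is integration by parts on I_n followed by the affine changes
of variables x = t_n(tau), s = t_l(sigma), together with

  t_n(tau) - t_l(sigma) = D (1 + Delta(tau, sigma)),

which turns the kernel (x - s)^(alpha-1) into D^(alpha-1) times the one on the
reference square.  The only difficulty is analytic: when l = n - 1 the
derivative of rho blows up at the left end of I_n, so the fundamental theorem
of calculus for continuous integrands does not apply.

The singularity is controlled by making rho explicit.  For a polynomial q let

  S(s, x) = sum_k q^(k)(s) (x - s)^(alpha+k) / (alpha (alpha+1) ... (alpha+k))

be the fractional integral of q over [s, x], that is, the integral of
(x - y)^(alpha-1) q(y) over y in [s, x] ([fracint]).  Iterated integration by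
parts in y makes the sum telescope, so that -S is a primitive in s of the
integrand of rho ([is_derive_fracint_lower]), and hence with a = t_(l-1),
b = t_l and V(x) = S(a, x) - S(b, x),

  Gamma(alpha) rho(x) = V(x)   for x >= b.

The same computation after an affine change of s gives the inner integrals of
A, B and C ([Rintegral_Delta_fracint]), so every sigma-integral becomes a value
of V.  Each term of V is a power of x - a or of x - b with a positive exponent;
thus V is continuous up to x = b, and V' has at worst the integrable singularity
(x - b)^(alpha-1) ([is_derive_fracint]).  A fundamental theorem of calculus that
asks for the continuity of the derivative in the open interval only, plus its
integrability ([Rintegral_itvoo_FTC]), then yields integration by parts for V
against a polynomial ([fracint_by_parts]), which is the claim after
substituting x = t_n(tau) in the last integral. *)

(** * The fundamental theorem of calculus with singular endpoints *)

Lemma integrable_itv_oo_cc (R : realType) (a b : R) (f : R -> R) :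
  lebesgue_measure.-integrable `]a, b[ (EFin \o f) ->
  lebesgue_measure.-integrable `[a, b] (EFin \o f).
Proof.
move=> /integrableP[mf foo]; apply/integrableP; split.
  apply/measurable_EFinP/measurable_fun_itv_bndo_bndcP.
  by apply/measurable_fun_itv_obnd_cbndP; exact/measurable_EFinP.
by rewrite integral_itv_bndoo//; exact: measurableT_comp.
Qed.

Lemma Rintegral_itv_oo_cc (R : realType) (a b : R) (f : R -> R) :
  measurable_fun `]a, b[ f ->
  \int[lebesgue_measure]_(x in `[a, b]) f x =
  \int[lebesgue_measure]_(x in `]a, b[) f x.
Proof.
by move=> mf; congr fine; rewrite integral_itv_bndoo//; exact/measurable_EFinP.
Qed.

Lemma continuous_in_itvoo_measurable (R : realType) (a b : R) (f : R -> R) :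
  {in `]a, b[, continuous f} -> measurable_fun `]a, b[ f.
Proof.
move=> cf; apply: open_continuous_measurable_fun => //.
by move=> x; rewrite inE/=; exact: cf.
Qed.

(** F minus the indefinite integral of f is continuous on [a, b] with zero
derivative inside, hence has equal values at a and b.  A blow-up of f at an
endpoint is harmless, because only F carries boundary values. *)
Lemma Rintegral_itvoo_FTC (R : realType) (a b : R) (F f : R -> R) :
  a < b -> continuous F ->
  (forall x, x \in `]a, b[ -> is_derive x 1 F (f x)) ->
  {in `]a, b[, continuous f} ->
  lebesgue_measure.-integrable `]a, b[ (EFin \o f) ->
  \int[lebesgue_measure]_(x in `]a, b[) f x = F b - F a.
Proof.
move=> ab cF dF cf fi; have fi' := integrable_itv_oo_cc fi.
rewrite -Rintegral_itv_oo_cc; last exact: continuous_in_itvoo_measurable.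
pose G x := parameterized_integral lebesgue_measure a x f.
have dG x : x \in `]a, b[ -> is_derive x 1 G (f x).
  move=> /[dup] xab; rewrite in_itv/= => /andP[ax xb].
  have [dGx <-] := continuous_FTC1_closed xb fi' ax (cf x xab).
  by rewrite derive1E; exact: derivableP.
have [||x _] := @MVT R (F \- G) (cst 0) a b ab.
- by move=> x xab; rewrite /= -(subrr (f x)); apply: is_deriveB; [exact: dF|exact: dG].
- move=> x; apply: (@continuousB _ R^o (subspace `[a, b]) F G).
    by apply: continuous_subspaceT; exact: cF.
  exact: (parameterized_integral_continuous (ltW ab) fi').
rewrite /=; have -> : G a = 0 by rewrite /G /parameterized_integral set_itv1 Rintegral_set1.
by rewrite mul0r subr0 /G /parameterized_integral; lra.
Qed.

(** Source of all integrability statements about singular kernels: the integrals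
of f over an exhaustion of ]a, b[ by segments are increments of F, which
converge to F b - F a because F is continuous up to the endpoints; monotone
convergence concludes. *)
Lemma ge0_integrable_derive (R : realType) (a b : R) (F f : R -> R) :
  a < b -> continuous F ->
  (forall x, x \in `]a, b[ -> is_derive x 1 F (f x)) ->
  {in `]a, b[, continuous f} ->
  (forall x, x \in `]a, b[ -> 0 <= f x) ->
  lebesgue_measure.-integrable `]a, b[ (EFin \o f).
Proof.
move=> ab cF dF cf f0.
(* The margin h n is at most (b - a) / 4, so no segment E n is degenerate. *)
pose h n := (b - a) / 2 * harmonic n.+1 : R.
have h0 n : 0 < h n by rewrite mulr_gt0// ?divr_gt0// ?subr_gt0// ?harmonic_gt0.
have hle n : h n <= (b - a) / 4.
  rewrite /h /harmonic/= -mulrA ler_pM2l ?subr_gt0// -invfM lef_pV2 ?posrE//.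
  by rewrite -natrM ler_nat !mulnS addnA leq_addr.
have hcvg : h n @[n --> \oo] --> 0.
  rewrite -(mulr0 ((b - a) / 2)); apply: cvgM; first exact: cvg_cst.
  by rewrite (cvg_shiftS (@harmonic R)); exact: cvg_harmonic.
pose E n : set R := `[a + h n, b - h n]%classic.
have EE n x : E n x = (a + h n <= x <= b - h n) :> Prop by rewrite /E/= in_itv.
have EU : \bigcup_n E n = `]a, b[%classic.
  apply/seteqP; split=> [x [n _]|x]; rewrite /= in_itv/=.
    by rewrite EE => /andP[? ?]; have ? := h0 n; apply/andP; split; lra.
  move=> /andP[ax xb].
  have e0 : 0 < Num.min (x - a) (b - x) by rewrite lt_min !subr_gt0 ax xb.
  have [n _ /(_ n (leqnn n))] := cvgr_lt 0 hcvg _ e0.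
  rewrite lt_min => /andP[? ?].
  by exists n => //; rewrite EE; apply/andP; split; lra.
have Eoo n x : E n x -> x \in `]a, b[.
  by move=> Enx; have : (\bigcup_n E n) x by [exists n]; rewrite EU.
have ltE n : a + h n < b - h n by have := hle n; lra.
have mE n : measurable_fun (E n) (EFin \o f).
  apply/measurable_EFinP; apply: measurable_funS (continuous_in_itvoo_measurable cf) => //.
  exact: Eoo.
have intE n : (\int[lebesgue_measure]_(x in E n) (f x)%:E)%E =
    (F (b - h n) - F (a + h n))%:E.
  rewrite EFinB; apply: continuous_FTC2 => //.
  - apply: continuous_in_subspaceT => x; rewrite inE => /Eoo; exact: cf.
  - split=> [x xE||].
    + have /Eoo/dF[] // : E n x by exact: subset_itv_oo_cc.
    + by apply: cvg_at_right_filter; exact: cF.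
    + by apply: cvg_at_left_filter; exact: cF.
  - move=> x xE; rewrite derive1E.
    have /Eoo/dF[] // : E n x by exact: subset_itv_oo_cc.
have ndE : nondecreasing_seq E.
  apply/nondecreasing_seqP => n; rewrite subsetEset => x.
  have : h n.+1 <= h n.
    rewrite /h ler_pM2l ?divr_gt0// ?subr_gt0// /harmonic/=.
    by rewrite lef_pV2 ?posrE// ler_nat.
  by rewrite !EE => ? /andP[? ?]; apply/andP; split; lra.
have cvgE : (\int[lebesgue_measure]_(x in E n) (f x)%:E)%E @[n --> \oo] -->
    (\int[lebesgue_measure]_(x in `]a, b[) (f x)%:E)%E.
  rewrite -EU; apply: ge0_nondecreasing_set_cvg_integral => //.
    by move=> n; exact: measurable_itv.
  by move=> n x /Eoo/f0; rewrite lee_fin.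
have cvgF : (\int[lebesgue_measure]_(x in E n) (f x)%:E)%E @[n --> \oo] -->
    (F b - F a)%:E.
  under eq_cvg do rewrite intE.
  apply: cvg_EFin; first exact: nearW.
  apply: cvgB; (apply: continuous_cvg; first exact: cF).
    by rewrite -[X in _ --> X]subr0; apply: cvgB => //; exact: cvg_cst.
  by rewrite -[X in _ --> X]addr0; apply: cvgD => //; exact: cvg_cst.
apply/integrableP; split.
  by apply/measurable_EFinP; exact: continuous_in_itvoo_measurable.
rewrite (_ : (\int[_]_(x in _) _)%E = (\int[lebesgue_measure]_(x in `]a, b[) (f x)%:E)%E).
  by rewrite (cvg_unique _ cvgE cvgF)// ltry.
by apply: eq_integral => x; rewrite inE => /f0 ?; rewrite /= ger0_norm.
Qed.

(** * Truncated powers *)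

(** The truncation matters: y `^ a is 1 for negative y, so it jumps at 0, whereas
tpow a is continuous on the whole line when 0 < a.  Primitives built from it are
continuous everywhere and need no one-sided limits at the singular endpoint. *)
Definition tpow (R : realType) (a y : R) : R := Num.max 0 y `^ a.

Lemma tpow_gt0E (R : realType) (a y : R) : 0 < y -> tpow a y = y `^ a.
Proof. by move=> y0; rewrite /tpow max_r// ltW. Qed.

Lemma tpow_le0E (R : realType) (a y : R) : 0 < a -> y <= 0 -> tpow a y = 0.
Proof. by move=> a0 y0; rewrite /tpow max_l// powR0// gt_eqF. Qed.

Lemma is_derive_tpow (R : realType) (a y : R) : 0 < y ->
  is_derive y 1 (tpow a) (a * y `^ (a - 1)).
Proof.
move=> y0; apply: (near_eq_is_derive _ (is_derive1_powR a y0)).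
by near=> z; rewrite tpow_gt0E//; near: z; exact: lt_nbhsr.
Unshelve. all: by end_near. Qed.

Lemma continuous_powR_gt0 (R : realType) (a y : R) : 0 < y ->
  {for y, continuous (fun x => x `^ a)}.
Proof.
move=> y0; apply/differentiable_continuous/derivable1_diffP.
by have [] := is_derive1_powR a y0.
Qed.

Lemma continuous_tpow (R : realType) (a : R) : 0 < a -> continuous (tpow a).
Proof.
move=> a0 y; have [y0|y0|->] := ltgtP y 0.
- rewrite /continuous_at tpow_le0E ?ltW//; apply: cvg_near_cst.
  by near=> x; apply: tpow_le0E => //; apply: ltW; near: x; exact: lt_nbhsl.
- apply/differentiable_continuous/derivable1_diffP.
  by have [] := is_derive_tpow a y0.
- apply/left_right_continuousP; rewrite tpow_le0E//; split.
    apply: cvg_near_cst; apply: filterS (nbhs_left_le (0 : R)) => x.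
    exact: tpow_le0E.
  apply: cvg_trans (powR_cvg0 a0).
  apply: near_eq_cvg; apply: filterS (nbhs_right_gt (0 : R)) => x x0.
  by rewrite tpow_gt0E.
Unshelve. all: by end_near. Qed.

Lemma is_derive_affine (R : realType) (p h y : R) :
  is_derive y 1 (fun x => p + h * x) h.
Proof.
have -> : h = 0 + h *: (1 : R) by rewrite add0r scaler1.
rewrite {1}add0r {1}scaler1.
apply: is_deriveD; exact: is_deriveZ.
Qed.

Lemma continuous_affine (R : realType) (p h : R) : continuous (fun x => p + h * x).
Proof.
move=> y; apply/differentiable_continuous/derivable1_diffP.
by have [] := is_derive_affine p h y.
Qed.

(** The exponent a - 1 may be negative: the base is allowed to vanish at either
end of the interval, and tpow a of the base is, up to a factor, a primitive. *)
Lemma integrable_affine_powR (R : realType) (a p h u v : R) :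
  0 < a -> h != 0 -> u < v -> (forall y, y \in `]u, v[ -> 0 < p + h * y) ->
  lebesgue_measure.-integrable `]u, v[
    (EFin \o (fun y => (p + h * y) `^ (a - 1))).
Proof.
move=> a0 h0 uv pos.
apply: (@ge0_integrable_derive R u v
  (fun y => (h * a)^-1 * tpow a (p + h * y))) => //.
- move=> y; apply: cvgM; first exact: cvg_cst.
  apply: (@continuous_comp _ _ _ (fun y => p + h * y) (tpow a)).
    exact: continuous_affine.
  exact: continuous_tpow.
- move=> y /pos py.
  rewrite (_ : _ `^ _ = (h * a)^-1 *: ((a * (p + h * y) `^ (a - 1)) * h)).
    apply: is_deriveZ; apply: (@is_derive1_comp _ (tpow a)).
      exact: is_derive_tpow.
    exact: is_derive_affine.
  by rewrite /GRing.scale/=; field; rewrite h0 gt_eqF.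
- move=> y /pos py; apply: (@continuous_comp _ _ _ (fun y => p + h * y) (fun x => x `^ (a - 1))).
    exact: continuous_affine.
  exact: continuous_powR_gt0.
- by move=> y _; exact: powR_ge0.
Qed.

Lemma integrable_affine_powRM (R : realType) (a p h u v : R) (g : R -> R) :
  0 < a -> h != 0 -> u < v -> (forall y, y \in `]u, v[ -> 0 < p + h * y) ->
  continuous g ->
  lebesgue_measure.-integrable `]u, v[
    (EFin \o (fun y => (p + h * y) `^ (a - 1) * g y)).
Proof.
move=> a0 h0 uv pos cg.
have -> : EFin \o (fun y => (p + h * y) `^ (a - 1) * g y) =
    ((EFin \o (fun y => (p + h * y) `^ (a - 1))%R) \* (EFin \o g))%E by [].
apply: integrableMl => //.
- exact: integrable_affine_powR.
- by apply: measurable_funTS; exact: continuous_measurable_fun.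
- have [M [Mreal gM]] := compact_bounded (continuous_compact
    (continuous_subspaceT cg) (@segment_compact _ u v)).
  exists M; split=> // N MN y yuv.
  by apply: (gM N MN); exists y => //; exact: subset_itv_oo_cc.
Qed.

(** * Fractional integrals of polynomials *)

(** The Riemann-Liouville integral of q over [s, x], without the factor
1 / Gamma a: the recursion is integration by parts in the integral of
(x - y)^(a-1) q(y), which raises the exponent and differentiates q.  The bound k
on the number of steps makes the recursion structural; all k >= size q give the
same function, since the derivatives of q eventually vanish. *)
Fixpoint fracint (R : realType) (k : nat) (a : R) (q : {poly R}) (s x : R) : R :=
  if k is k'.+1 then
    a^-1 * (q.[s] * tpow a (x - s) + fracint k' (a + 1) q^`() s x)
  else 0.

Lemma is_derive_horner (R : realType) (q : {poly R}) (s : R) :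
  is_derive s 1 (horner q) q^`().[s].
Proof.
by rewrite derivE derive1E; apply: derivableP; exact: derivable_horner.
Qed.

Lemma continuous_fracint_lower (R : realType) (k : nat) (a : R) (q : {poly R}) (x : R) :
  0 < a -> continuous (fun s => fracint k a q s x).
Proof.
elim: k a q => [|k IH] a q a0 s /=; first exact: cvg_cst.
apply: cvgM; first exact: cvg_cst.
apply: cvgD; last by apply: IH; rewrite addr_gt0.
apply: cvgM; first exact: continuous_horner.
apply: (@continuous_comp _ _ _ (fun s => x - s) (tpow a)).
  by apply: cvgB; [exact: cvg_cst|exact: cvg_id].
exact: continuous_tpow.
Qed.

Lemma continuous_fracint (R : realType) (k : nat) (a : R) (q : {poly R}) (s : R) :
  0 < a -> continuous (fracint k a q s).
Proof.
elim: k a q => [|k IH] a q a0 x /=; first exact: cvg_cst.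
apply: cvgM; first exact: cvg_cst.
apply: cvgD; last by apply: IH; rewrite addr_gt0.
apply: cvgM; first exact: cvg_cst.
apply: (@continuous_comp _ _ _ (fun x => x - s) (tpow a)).
  by apply: cvgB; [exact: cvg_id|exact: cvg_cst].
exact: continuous_tpow.
Qed.

Lemma size_deriv_leq (R : idomainType) (q : {poly R}) (k : nat) :
  (size q <= k.+1)%N -> (size q^`() <= k)%N.
Proof.
have [->|q0] := eqVneq q 0; first by rewrite deriv0 size_poly0.
by move=> szq; rewrite -ltnS; apply: leq_trans szq; exact: lt_size_deriv.
Qed.

(** In the recursion the boundary term contributes the derivative of q, which
cancels the derivative of the remaining fractional integral. *)
Lemma is_derive_fracint_lower (R : realType) (k : nat) (a : R) (q : {poly R}) (s x : R) :
  0 < a -> s < x -> (size q <= k)%N ->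
  is_derive s 1 (fun s => fracint k a q s x) (- ((x - s) `^ (a - 1) * q.[s])).
Proof.
move=> a0 sx; elim: k a a0 q => [|k IH] a a0 q szq.
  move: szq; rewrite leqn0 size_poly_eq0 => /eqP ->.
  by rewrite horner0 mulr0 oppr0; exact: is_derive_cst.
have dq := size_deriv_leq szq.
have xs : 0 < x - s by rewrite subr_gt0.
have dt : is_derive s 1 (fun s => tpow a (x - s)) (a * (x - s) `^ (a - 1) * -1).
  apply: (@is_derive1_comp _ (tpow a)); first exact: is_derive_tpow.
  by rewrite -[-1]add0r; apply: is_deriveB.
have := is_deriveZ a^-1 (is_deriveD (is_deriveM (is_derive_horner q s) dt)
  (IH (a + 1) (ltr_pwDr ltr01 (ltW a0)) _ dq)).
rewrite /GRing.scale/= addrK tpow_gt0E//.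
set D := (X in is_derive _ _ _ X -> _); set D' := (X in _ -> is_derive _ _ _ X).
suff -> : D = D' by [].
by rewrite /D /D'; field; rewrite gt_eqF.
Qed.

(** Leibniz rule: after the substitution y -> x - y the integrand depends on x
through q only, which gives the fractional integral of q', and the moving end
gives the boundary term.  This form isolates the only singular term,
(x - s)^(a-1). *)
Lemma is_derive_fracint (R : realType) (k : nat) (a : R) (q : {poly R}) (s x : R) :
  0 < a -> s < x -> (size q <= k)%N ->
  is_derive x 1 (fracint k a q s)
    ((x - s) `^ (a - 1) * q.[s] + fracint k a q^`() s x).
Proof.
move=> a0 sx; elim: k a a0 q => [|k IH] a a0 q szq.
  move: szq; rewrite leqn0 size_poly_eq0 => /eqP ->.
  by rewrite horner0 mulr0 addr0; exact: is_derive_cst.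
have dq := size_deriv_leq szq.
have xs : 0 < x - s by rewrite subr_gt0.
have dt : is_derive x 1 (fun x => tpow a (x - s)) (a * (x - s) `^ (a - 1) * 1).
  apply: (@is_derive1_comp _ (tpow a)); first exact: is_derive_tpow.
  by rewrite -[X in is_derive _ _ _ X]subr0; apply: is_deriveB.
have := is_deriveZ a^-1 (is_deriveD (is_deriveZ q.[s] dt)
  (IH (a + 1) (ltr_pwDr ltr01 (ltW a0)) _ dq)).
rewrite /GRing.scale/= addrK tpow_gt0E//.
set D := (X in is_derive _ _ _ X -> _); set D' := (X in _ -> is_derive _ _ _ X).
suff -> : D = D' by [].
by rewrite /D /D'; field; rewrite gt_eqF.
Qed.

Lemma integrable_fracint_kernel (R : realType) (a : R) (q : {poly R}) (x m h u v : R) :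
  0 < a -> 0 < h -> u < v -> m + h * v <= x ->
  lebesgue_measure.-integrable `]u, v[
    (EFin \o (fun y => (x - (m + h * y)) `^ (a - 1) * q.[m + h * y])).
Proof.
move=> a0 h0 uv vx.
have pos y : y \in `]u, v[ -> m + h * y < x.
  rewrite in_itv/= => /andP[_ yv]; apply: lt_le_trans vx.
  by rewrite ltrD2l ltr_pM2l.
have -> : (fun y => (x - (m + h * y)) `^ (a - 1) * q.[m + h * y]) =
          (fun y => ((x - m) + (- h) * y) `^ (a - 1) * q.[m + h * y]).
  by apply/funext => y; congr (_ `^ _ * _); ring.
apply: (@integrable_affine_powRM _ a (x - m) (- h) u v (fun y => q.[m + h * y])) => //.
- by rewrite oppr_eq0 gt_eqF.
- by move=> y /pos; lra.
- move=> y; apply: (@continuous_comp _ _ _ (fun y => m + h * y) (horner q)).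
    exact: continuous_affine.
  exact: continuous_horner.
Qed.

(** Allowing an affine variable lets this one computation serve both the integral
that defines rho and the integrals over the reference interval.  Equality
m + h * v = x, where the integrand may be unbounded, is permitted. *)
Lemma Rintegral_fracint (R : realType) (k : nat) (a : R) (q : {poly R}) (x m h u v : R) :
  0 < a -> (size q <= k)%N -> 0 < h -> u < v -> m + h * v <= x ->
  \int[lebesgue_measure]_(y in `]u, v[)
    ((x - (m + h * y)) `^ (a - 1) * q.[m + h * y]) =
  h^-1 * (fracint k a q (m + h * u) x - fracint k a q (m + h * v) x).
Proof.
move=> a0 szq h0 uv vx.
have pos y : y \in `]u, v[ -> m + h * y < x.
  rewrite in_itv/= => /andP[_ yv]; apply: lt_le_trans vx.
  by rewrite ltrD2l ltr_pM2l.
pose F y := (- h^-1) * fracint k a q (m + h * y) x.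
transitivity (F v - F u); last by rewrite /F; ring.
apply: Rintegral_itvoo_FTC => //.
- move=> y; apply: cvgM; first exact: cvg_cst.
  apply: (@continuous_comp _ _ _ (fun y => m + h * y) (fun s => fracint k a q s x)).
    exact: continuous_affine.
  exact: continuous_fracint_lower.
- move=> y /pos yx.
  have := is_deriveZ (- h^-1) (@is_derive1_comp _ (fun s => fracint k a q s x)
    (fun y => m + h * y) y _ _ (is_derive_fracint_lower a0 yx szq) (is_derive_affine m h y)).
  set D := (X in is_derive _ _ _ X -> _); set D' := (X in _ -> is_derive _ _ _ X).
  suff -> : D = D' by [].
  by rewrite /D /D' /GRing.scale/=; field; rewrite gt_eqF.
- move=> y /pos yx; apply: cvgM.
    apply: (@continuous_comp _ _ _ (fun y => x - (m + h * y)) (fun z => z `^ (a - 1))).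
      by apply: cvgB; [exact: cvg_cst|exact: continuous_affine].
    by apply: continuous_powR_gt0; rewrite subr_gt0.
  apply: (@continuous_comp _ _ _ (fun y => m + h * y) (horner q)).
    exact: continuous_affine.
  exact: continuous_horner.
exact: integrable_fracint_kernel.
Qed.

(** * Integration by parts and substitution *)

Lemma continuous_integrable_itvoo (R : realType) (a b : R) (f : R -> R) :
  continuous f -> lebesgue_measure.-integrable `]a, b[ (EFin \o f).
Proof.
move=> cf; apply: (@integrableS _ _ _ lebesgue_measure `[a, b]) => //.
  exact: subset_itv_oo_cc.
apply: continuous_compact_integrable; first exact: segment_compact.
exact: continuous_subspaceT.
Qed.

(** For k >= size q the first factor of the integrand is the derivative in x of
fracint; when s = c it may be unbounded near c. *)
Lemma integrable_derive_fracint (R : realType) (k : nat) (a : R) (q : {poly R})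
    (s c d : R) (g : R -> R) :
  0 < a -> s <= c -> c < d -> continuous g ->
  lebesgue_measure.-integrable `]c, d[
    (EFin \o (fun x => ((x - s) `^ (a - 1) * q.[s] + fracint k a q^`() s x) * g x)).
Proof.
move=> a0 sc cd cg.
have -> : (fun x => ((x - s) `^ (a - 1) * q.[s] + fracint k a q^`() s x) * g x) =
    (fun x => (- s + 1 * x) `^ (a - 1) * (q.[s] * g x) + fracint k a q^`() s x * g x).
  by apply/funext => x; rewrite mul1r (addrC _ x) mulrDl mulrA.
rewrite (_ : EFin \o _ =
  (EFin \o (fun x => ((- s + 1 * x) `^ (a - 1) * (q.[s] * g x))%R)) \+
  (EFin \o (fun x => (fracint k a q^`() s x * g x)%R)))%E; last first.
  by apply/funext => x; rewrite /= EFinD.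
apply: integrableD => //.
- apply: integrable_affine_powRM => //.
    by move=> y; rewrite in_itv/= => /andP[cy _]; lra.
  by move=> x; apply: cvgM; [exact: cvg_cst|exact: cg].
- apply: continuous_integrable_itvoo => x.
  by apply: cvgM; [exact: continuous_fracint|exact: cg].
Qed.

(** V is the integral of (x - y)^(a-1) q(y) over y in [s1, s2].  The lower limits
may touch c, as they do for adjacent grid intervals. *)
Lemma fracint_by_parts (R : realType) (k : nat) (a : R) (q p : {poly R})
    (s1 s2 c d : R) :
  0 < a -> (size q <= k)%N -> s1 <= c -> s2 <= c -> c < d ->
  let V x := fracint k a q s1 x - fracint k a q s2 x in
  \int[lebesgue_measure]_(x in `]c, d[) (derive1 V x * p.[x]) =
  V d * p.[d] - V c * p.[c] -
  \int[lebesgue_measure]_(x in `]c, d[) (V x * p^`().[x]).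
Proof.
move=> a0 szq s1c s2c cd V.
pose phi s x := (x - s) `^ (a - 1) * q.[s] + fracint k a q^`() s x.
have cV : continuous V.
  by move=> x; apply: cvgB; exact: continuous_fracint.
have cp (u : {poly R}) : continuous (horner u) by exact: continuous_horner.
have cphi s x : s <= c -> x \in `]c, d[ -> {for x, continuous (phi s)}.
  rewrite in_itv/= => sc /andP[cx _]; apply: cvgD; last exact: continuous_fracint.
  apply: cvgM; last exact: cvg_cst.
  apply: (@continuous_comp _ _ _ (fun x => x - s) (fun z => z `^ (a - 1))).
    by apply: cvgB; [exact: cvg_id|exact: cvg_cst].
  by apply: continuous_powR_gt0; rewrite subr_gt0 (le_lt_trans sc).
have dV x : x \in `]c, d[ -> is_derive x 1 V (phi s1 x - phi s2 x).
  rewrite in_itv/= => /andP[cx _].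
  by apply: is_deriveB; apply: is_derive_fracint => //; exact: le_lt_trans cx.
have iphi s : s <= c -> lebesgue_measure.-integrable `]c, d[
    (EFin \o (fun x => phi s x * p.[x])).
  by move=> sc; apply: integrable_derive_fracint.
pose W x := (phi s1 x - phi s2 x) * p.[x].
have iW : lebesgue_measure.-integrable `]c, d[ (EFin \o W).
  rewrite (_ : EFin \o W = (EFin \o (fun x => phi s1 x * p.[x])%R) \-
    (EFin \o (fun x => phi s2 x * p.[x])%R))%E; last first.
    by apply/funext => x; rewrite /W /= mulrBl EFinB.
  by apply: integrableB => //; exact: iphi.
have iVp : lebesgue_measure.-integrable `]c, d[ (EFin \o (fun x => V x * p^`().[x])).
  apply: continuous_integrable_itvoo => x.
  by apply: cvgM; [exact: cV|exact: cp].
have -> : \int[lebesgue_measure]_(x in `]c, d[) (derive1 V x * p.[x]) =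
    \int[lebesgue_measure]_(x in `]c, d[) W x.
  apply: eq_Rintegral => x; rewrite inE/= => xcd; rewrite /W derive1E; congr (_ * _).
  by have [_ ->] := dV x xcd.
apply/eqP; rewrite eq_sym subr_eq eq_sym; apply/eqP.
rewrite -RintegralD//.
apply: (@Rintegral_itvoo_FTC _ _ _ (fun x => V x * p.[x])) => //.
- by move=> x; apply: cvgM; [exact: cV|exact: cp].
- move=> x /dV dVx; have := is_deriveM dVx (is_derive_horner p x).
  set D := (X in is_derive _ _ _ X -> _); set D' := (X in _ -> is_derive _ _ _ X).
  suff -> : D = D' by [].
  by rewrite /D /D' /W /GRing.scale/=; ring.
- move=> x xcd; apply: cvgD; last by apply: cvgM; [exact: cV|exact: cp].
  by apply: cvgM; [apply: cvgB; exact: cphi|exact: cp].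
- rewrite (_ : EFin \o _ = (EFin \o W) \+ (EFin \o (fun x => V x * p^`().[x])%R))%E.
    exact: integrableD.
  by apply/funext => x; rewrite /= EFinD.
Qed.

Lemma continuous_affine_substitution (R : realType) (m h u v : R) (G : R -> R) :
  0 < h -> u < v -> continuous G ->
  \int[lebesgue_measure]_(x in `]m + h * u, m + h * v[) G x =
  \int[lebesgue_measure]_(y in `[u, v]) (h * G (m + h * y)).
Proof.
move=> h0 uv cG.
pose phi y : R := m + h * y.
have dphi : phi^`()%classic = cst h.
  by apply/funext => y; rewrite derive1E; have [_ ->] := is_derive_affine m h y.
have cphi : continuous phi by exact: continuous_affine.
rewrite -Rintegral_itv_oo_cc; last first.
  by apply: measurable_funTS; exact: continuous_measurable_fun.
rewrite /Rintegral (@integration_by_substitution_increasing _ phi) ?ltW//.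
- by congr fine; apply: eq_integral => y _; rewrite dphi /= mulrC.
- by move=> x y _ _ xy; rewrite ltrD2l ltr_pM2l.
- by rewrite dphi => x _; exact: cvg_cst.
- by rewrite dphi; apply: is_cvg_cst.
- by rewrite dphi; apply: is_cvg_cst.
- split=> [x _||].
  + by have [] := is_derive_affine m h x.
  + by apply: cvg_at_right_filter; exact: cphi.
  + by apply: cvg_at_left_filter; exact: cphi.
- exact: continuous_subspaceT.
Qed.

(** * Grid geometry and the kernel on the reference interval *)

Lemma grid_le (R : realType) (t : nat -> R) (N m k : nat) :
  (forall m : nat, (1 <= m <= N)%N -> t m.-1 < t m) ->
  (m <= k <= N)%N -> t m <= t k.
Proof.
move=> ht; elim: k => [|k IH] /andP[mk kN]; first by move: mk; rewrite leqn0 => /eqP->.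
move: mk; rewrite leq_eqVlt => /predU1P[->//|mk].
by apply: (le_trans (IH _)); [rewrite -ltnS mk ltnW|apply/ltW/(ht k.+1)].
Qed.

Lemma refmapE (R : realType) (t : nat -> R) (n : nat) (tau : R) :
  refmap t n tau = midpoint t n + step t n / 2 * tau.
Proof. by rewrite /refmap /midpoint /step; field. Qed.

Lemma DeltaE (R : realType) (t : nat -> R) (n l : nat) (tau sigma : R) :
  Ddist t n l != 0 ->
  Ddist t n l * (1 + Delta t n l tau sigma) = refmap t n tau - refmap t l sigma.
Proof.
by move=> D0; rewrite !refmapE /Delta /Ddist; field.
Qed.

(** The common form of the inner integrals of A, B and C, for tau = 1, tau = -1
and general tau respectively. *)
Lemma Rintegral_Delta_fracint (R : realType) (k : nat) (alpha : R) (t : nat -> R) (n l : nat)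
    (q : {poly R}) (tau : R) :
  0 < alpha -> (size q <= k)%N -> 0 < Ddist t n l -> 0 < step t l ->
  t l <= refmap t n tau ->
  Ddist t n l `^ (alpha - 1) * (step t l / 2) *
  \int[lebesgue_measure]_(sigma in `[-1, 1])
    ((1 + Delta t n l tau sigma) `^ (alpha - 1) * q.[refmap t l sigma]) =
  fracint k alpha q (t l.-1) (refmap t n tau) -
  fracint k alpha q (t l) (refmap t n tau).
Proof.
move=> alpha0 szq D0 k0 tx; set x := refmap t n tau.
set D := Ddist t n l; set m := midpoint t l; set h := step t l / 2.
have h0 : 0 < h by rewrite divr_gt0.
have N11 : -1 < 1 :> R by lra.
have lo : m + h * -1 = t l.-1 by rewrite /m /h /midpoint /step; field.
have hi : m + h * 1 = t l by rewrite /m /h /midpoint /step; field.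
have K0 : D `^ (alpha - 1) != 0 by rewrite gt_eqF// powR_gt0.
have hix : m + h * 1 <= x by rewrite hi.
have ker := integrable_fracint_kernel q alpha0 h0 N11 hix.
transitivity (D `^ (alpha - 1) * h * \int[lebesgue_measure]_(y in `[-1, 1])
  ((D `^ (alpha - 1))^-1 * ((x - (m + h * y)) `^ (alpha - 1) * q.[m + h * y]))).
  congr (_ * _); apply: eq_Rintegral => sigma.
  rewrite inE/= in_itv/= => /andP[_ sigma1].
  have -> : x - (m + h * sigma) = D * (1 + Delta t n l tau sigma).
    by rewrite DeltaE ?gt_eqF// (refmapE t l).
  rewrite (refmapE t l) powRM ?(ltW D0)//; first by field.
  rewrite -(pmulr_rge0 _ D0) DeltaE ?gt_eqF// subr_ge0 (refmapE t l).
  by apply: le_trans hix; rewrite lerD2l ler_pM2l.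
rewrite Rintegral_itv_oo_cc; last first.
  apply: measurable_funM => //.
  by case/integrableP : ker => /measurable_EFinP.
rewrite RintegralZl// (Rintegral_fracint _ szq)// lo hi.
by field; rewrite K0 gt_eqF.
Qed.

(** * The formula for H *)

Theorem lemma4 (R : realType) (alpha : R) (halpha : 0 < alpha < 1)
  (N : nat) (T : R) (t : nat -> R)
  (ht0 : t 0%N = 0) (htN : t N = T)
  (ht : forall m : nat, (1 <= m <= N)%N -> t m.-1 < t m)
  (r : nat -> nat) (hr : forall m : nat, (1 <= m <= N)%N -> (1 <= r m)%N)
  (psi : forall m : nat, (r m).-tuple {poly_(r m) R})
  (hpsi : forall m : nat, (1 <= m <= N)%N ->
     basis_of {: {poly_(r m) R}} (psi m))
  (n l : nat) (hn : (1 <= n <= N)%N) (hl : (1 <= l <= n - 1)%N)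
  (i : 'I_(r n)) (j : 'I_(r l)) :
  Hcoef alpha t psi i j =
    (Ddist t n l) `^ (alpha - 1) / Gamma alpha * (step t l / 2) *
    (Psi t psi i 1 * Acoef alpha t psi n j
     - Psi t psi i (-1) * Bcoef alpha t psi n j
     - Ccoef alpha t psi i j).
Proof.
have /andP[alpha0 _] := halpha.
have /andP[n1 nN] := hn; have /andP[l1 ln1] := hl.
have lN : (1 <= l <= N)%N by rewrite l1 (leq_trans ln1)// (leq_trans (leq_subr _ _)).
have tl := ht l lN; have tn := ht n hn.
have tln : t l <= t n.-1 by apply: (grid_le ht); rewrite -subn1 ln1 (leq_trans (leq_subr _ _)).
have kl0 : 0 < step t l by rewrite subr_gt0.
have kn0 : 0 < step t n by rewrite subr_gt0.
have D0 : 0 < Ddist t n l by rewrite /Ddist /midpoint; lra.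
set q := polyn (tnth (psi l) j); set p := polyn (tnth (psi n) i).
pose V x := fracint (size q) alpha q (t l.-1) x - fracint (size q) alpha q (t l) x.
have cV : continuous V by move=> x; apply: cvgB; exact: continuous_fracint.
(* Every integral in sigma below is 1 / K times a value of V. *)
pose K := Ddist t n l `^ (alpha - 1) * (step t l / 2).
have K0 : K != 0 by rewrite gt_eqF// mulr_gt0 ?powR_gt0 ?divr_gt0.
have rhoE x : t l <= x -> rho alpha t psi j x = (Gamma alpha)^-1 * V x.
  move=> lx.
  have ker := @integrable_fracint_kernel _ alpha q x 0 1 _ _ alpha0 ltr01 tl.
  have e : (fun s => (x - (0 + 1 * s)) `^ (alpha - 1) * q.[0 + 1 * s]) =
           (fun s => (x - s) `^ (alpha - 1) * q.[s]).
    by apply/funext => s; rewrite add0r mul1r.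
  transitivity (\int[lebesgue_measure]_(s in subint t l)
    ((Gamma alpha)^-1 * ((x - s) `^ (alpha - 1) * q.[s]))).
    apply: eq_Rintegral => s _.
    by rewrite /omega_kernel /psifun -/q (mulrC (_ `^ _)) mulrA.
  rewrite /subint RintegralZl//; last by rewrite -e; apply: ker; rewrite add0r mul1r.
  congr (_ * _); rewrite -e (Rintegral_fracint alpha0 (leqnn (size q)))//.
    by rewrite invr1 !mul1r !add0r.
  by rewrite add0r mul1r.
have innerE tau : -1 <= tau <= 1 ->
    \int[lebesgue_measure]_(sigma in `[-1, 1])
      ((1 + Delta t n l tau sigma) `^ (alpha - 1) * Psi t psi j sigma) =
    K^-1 * V (refmap t n tau).
  move=> /andP[tau1 _].
  have lx : t l <= refmap t n tau.
    apply: (le_trans tln); rewrite refmapE /midpoint /step.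
    have tau0 : 0 <= tau + 1 by lra.
    by have := mulr_ge0 (ltW kn0) tau0; rewrite /step; lra.
  by rewrite /V -(Rintegral_Delta_fracint alpha0 (leqnn (size q)) D0 kl0 lx) -/K mulKf.
have refmap1 : refmap t n 1 = t n by rewrite /refmap; field.
have refmapN1 : refmap t n (-1) = t n.-1 by rewrite /refmap; field.
have AE : Acoef alpha t psi n j = K^-1 * V (t n).
  by rewrite /Acoef innerE ?refmap1//; lra.
have BE : Bcoef alpha t psi n j = K^-1 * V (t n.-1).
  by rewrite /Bcoef innerE ?refmapN1//; lra.
have dPsi tau : derive1 (Psi t psi i) tau = step t n / 2 * p^`().[refmap t n tau].
  rewrite /Psi /psifun -/p (_ : (fun tau => _) =
    horner p \o (fun tau => midpoint t n + step t n / 2 * tau)); last first.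
    by apply/funext => ? /=; rewrite refmapE.
  rewrite derive1E refmapE [RHS]mulrC.
  by have [_ ->] := is_derive1_comp (is_derive_horner p _)
    (is_derive_affine (midpoint t n) (step t n / 2) tau).
have iVp : lebesgue_measure.-integrable `]t n.-1, t n[
    (EFin \o (fun x => V x * p^`().[x])).
  apply: continuous_integrable_itvoo => x.
  by apply: cvgM; [exact: cV|exact: continuous_horner].
have CE : Ccoef alpha t psi i j =
    K^-1 * \int[lebesgue_measure]_(x in `]t n.-1, t n[) (V x * p^`().[x]).
  pose G x := K^-1 * (V x * p^`().[x]).
  have cG : continuous G.
    move=> x; apply: cvgM; first exact: cvg_cst.
    by apply: cvgM; [exact: cV|exact: continuous_horner].
  transitivity (\int[lebesgue_measure]_(y in `[-1, 1])
      (step t n / 2 * G (midpoint t n + step t n / 2 * y))).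
    apply: eq_Rintegral => tau; rewrite inE/= in_itv/= => tau1.
    by rewrite dPsi innerE// -refmapE /G; ring.
  have h0 : 0 < step t n / 2 by rewrite divr_gt0.
  have N11 : -1 < 1 :> R by lra.
  rewrite -(continuous_affine_substitution _ h0 N11 cG).
  by rewrite -!refmapE refmap1 refmapN1 RintegralZl.
(* Scaling p instead of the integral avoids asking for the integrability of
     V' p here. *)
have HE : Hcoef alpha t psi i j = \int[lebesgue_measure]_(x in `]t n.-1, t n[)
    (derive1 V x * ((Gamma alpha)^-1 *: p).[x]).
  apply: eq_Rintegral => x; rewrite inE /subint/= in_itv/= => /andP[cx _].
  have lx : t l < x := le_lt_trans tln cx.
  have dV : derivable V x 1.
    apply: derivableB.
      by have [] := is_derive_fracint alpha0 (lt_trans tl lx) (leqnn (size q)).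
    by have [] := is_derive_fracint alpha0 lx (leqnn (size q)).
  rewrite (_ : derive1 _ x = (Gamma alpha)^-1 * derive1 V x).
    by rewrite hornerZ /psifun -/p; ring.
  rewrite !derive1E (@near_eq_derive _ _ _ _ (fun x => (Gamma alpha)^-1 *: V x)).
    by rewrite deriveZ.
  near=> y; apply: rhoE; apply: ltW; near: y; exact: lt_nbhsr.
rewrite HE (fracint_by_parts _ alpha0 (leqnn _)) ?(le_trans (ltW tl))//.
rewrite -/(V _) -/(V _) derivZ !hornerZ.
under eq_Rintegral do rewrite hornerZ mulrCA.
rewrite RintegralZl// AE BE CE /Psi /psifun refmap1 refmapN1 -/p.
have -> : Ddist t n l `^ (alpha - 1) / Gamma alpha * (step t l / 2) = K / Gamma alpha.
  by rewrite /K mulrAC.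
(* Only the inverse of Gamma alpha occurs, so it is treated as an atom. *)
by move: (Gamma alpha)^-1 => g; field.
Unshelve. all: by end_near. Qed.
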